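(* The tangent Lie algebra $T(\mathbb{R}\times\mathfrak{aff}(\mathbb{R}))$ carries several (that is, more than one) Kähler structures.
   Context: $\mathfrak{aff}(\mathbb{R})$ is the two-dimensional real Lie algebra with basis $e_1,e_2$ and $[e_1,e_2]=e_2$. The tangent Lie algebra $T\mathfrak{h}=\mathfrak{h}\ltimes_{\mathrm{ad}}V$ ($V=\mathfrak{h}$ as a vector space) is $\mathfrak{h}\oplus V$ with bracket $[(x,v),(x',v')]=([x,x'],[x,v']-[x',v])$; thus $T(\mathbb{R}\times\mathfrak{aff}(\mathbb{R}))$ has basis $e_1,\dots,e_6$ with non-zero brackets $[e_1,e_2]=e_2$, $[e_1,e_5]=e_5$, $[e_2,e_4]=-e_5$. A complex structure on a real Lie algebra $\mathfrak{g}$ is a linear map $J$ with $J^2=-\mathrm{I}$ and $[Jx,Jy]-[x,y]-J[Jx,y]-J[x,Jy]=0$ for all $x,y\in\mathfrak{g}$. A symplectic structure is a non-degenerate 2-form $\omega$ with $\omega([x,y],z)+\omega([y,z],x)+\omega([z,x],y)=0$. A Kähler structure on $\mathfrak{g}$ is a pair $(J,\omega)$ of a complex structure and a symplectic structure with $\omega(Jx,Jy)=\omega(x,y)$ for all $x,y$ (no positivity is required). *)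

(* Defs.v *)
From HB Require Import structures.
From mathcomp Require Import all_boot all_order all_algebra.
From mathcomp Require Import ring.

Set Implicit Arguments.
Unset Strict Implicit.
Unset Printing Implicit Defensive.

Import GRing.Theory.
Local Open Scope ring_scope.

HB.mixin Record isLie (R : fieldType) (g : Type) of Vector R g := {
  lie : g -> g -> g;
  lie_bilinear : bilinear_for *:%R *:%R lie;
  lie_alternating : forall x, lie x x = 0;
  lie_jacobi : forall x y z,
    lie (lie x y) z + lie (lie y z) x + lie (lie z x) y = 0
}.

#[short(type="lieAlgType")]
HB.structure Definition LieAlgebra (R : fieldType) :=
  { g of isLie R g & Vector R g }.

Section LieTheory.
Variables (R : fieldType) (g : lieAlgType R).
Implicit Types (a : R) (x y z : g).

Lemma lieDl x y z : lie (x + y) z = lie x z + lie y z.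
Proof. by have := (@lie_bilinear R g).1 z 1 x y; rewrite /= !scale1r. Qed.

Lemma lieDr x y z : lie x (y + z) = lie x y + lie x z.
Proof. by have := (@lie_bilinear R g).2 x 1 y z; rewrite /= !scale1r. Qed.

Lemma lie0l x : lie 0 x = 0.
Proof. by apply: (addrI (lie 0 x)); rewrite -lieDl !addr0. Qed.

Lemma lie0r x : lie x 0 = 0.
Proof. by apply: (addrI (lie x 0)); rewrite -lieDr !addr0. Qed.

Lemma lieZl a x y : lie (a *: x) y = a *: lie x y.
Proof. by have := (@lie_bilinear R g).1 y a x 0; rewrite /= !addr0 lie0l addr0. Qed.

Lemma lieZr a x y : lie x (a *: y) = a *: lie x y.
Proof. by have := (@lie_bilinear R g).2 x a y 0; rewrite /= !addr0 lie0r addr0. Qed.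

Lemma lieNl x y : lie (- x) y = - lie x y.
Proof. by rewrite -scaleN1r lieZl scaleN1r. Qed.

Lemma lieNr x y : lie x (- y) = - lie x y.
Proof. by rewrite -scaleN1r lieZr scaleN1r. Qed.

Lemma lie_antisym x y : lie x y = - lie y x.
Proof.
have := lie_alternating (x + y).
rewrite lieDl !lieDr !lie_alternating add0r addr0 => /eqP.
by rewrite addr_eq0 => /eqP.
Qed.

Lemma lie_lie x y z : lie (lie x y) z = lie x (lie y z) - lie y (lie x z).
Proof.
apply/eqP; rewrite -subr_eq0 opprB -(lie_jacobi x y z).
rewrite (lie_antisym (lie y z) x) (lie_antisym (lie z x) y).
by rewrite (lie_antisym z x) lieNr opprK -addrA (addrC (- lie x _)).
Qed.
End LieTheory.

Section Line.
Variable R : fieldType.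

Definition line_lie (x y : R^o) : R^o := 0.

Fact line_lie_bilinear : bilinear_for *:%R *:%R line_lie.
Proof. by split=> u a x y; rewrite /line_lie /= scaler0 addr0. Qed.

Fact line_lie_alternating x : line_lie x x = 0. Proof. by []. Qed.

Fact line_lie_jacobi x y z :
  line_lie (line_lie x y) z + line_lie (line_lie y z) x
  + line_lie (line_lie z x) y = 0.
Proof. by rewrite /line_lie !addr0. Qed.

HB.instance Definition _ :=
  isLie.Build R R^o line_lie_bilinear line_lie_alternating line_lie_jacobi.
End Line.

Section Aff.
Variable R : fieldType.

Definition aff := 'rV[R]_2.
HB.instance Definition _ := Vector.on aff.

(* With e1 = delta_mx 0 0 and e2 = delta_mx 0 1, this is the alternating
   bilinear extension of [e1, e2] = e2. *)
Definition aff_lie (x y : aff) : aff :=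
  (x 0 0 * y 0 1 - x 0 1 * y 0 0) *: delta_mx 0 1.

Fact aff_lie_bilinear : bilinear_for *:%R *:%R aff_lie.
Proof.
split=> u a x y; rewrite /aff_lie /= scalerA -scalerDl; congr (_ *: _);
  rewrite !mxE; ring.
Qed.

Fact aff_lie_alternating x : aff_lie x x = 0.
Proof. by rewrite /aff_lie mulrC subrr scale0r. Qed.

Fact aff_lie_jacobi x y z :
  aff_lie (aff_lie x y) z + aff_lie (aff_lie y z) x
  + aff_lie (aff_lie z x) y = 0.
Proof.
rewrite /aff_lie -!scalerDl !mxE /= (_ : _ + _ = 0) ?scale0r //; ring.
Qed.

HB.instance Definition _ :=
  isLie.Build R aff aff_lie_bilinear aff_lie_alternating aff_lie_jacobi.
End Aff.

Section Product.
Variables (R : fieldType) (g h : lieAlgType R).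

Definition prod_lie (x y : g * h) : g * h := (lie x.1 y.1, lie x.2 y.2).

Fact prod_lie_bilinear : bilinear_for *:%R *:%R prod_lie.
Proof.
by split=> u a x y; congr pair => /=; rewrite ?(lieDl, lieDr) ?(lieZl, lieZr).
Qed.

Fact prod_lie_alternating x : prod_lie x x = 0.
Proof. by rewrite /prod_lie !lie_alternating. Qed.

Fact prod_lie_jacobi x y z :
  prod_lie (prod_lie x y) z + prod_lie (prod_lie y z) x
  + prod_lie (prod_lie z x) y = 0.
Proof. by congr pair; apply: lie_jacobi. Qed.

HB.instance Definition _ :=
  isLie.Build R (g * h)%type
    prod_lie_bilinear prod_lie_alternating prod_lie_jacobi.
End Product.

Section Tangent.
Variables (R : fieldType) (h : lieAlgType R).

(* An alias of [h * h], which already carries the direct product bracket. *)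
Definition tangent := (h * h)%type.
HB.instance Definition _ := Vector.on tangent.

Definition tangent_lie (x y : tangent) : tangent :=
  (lie x.1 y.1, lie x.1 y.2 - lie y.1 x.2).

Fact tangent_lie_bilinear : bilinear_for *:%R *:%R tangent_lie.
Proof.
by split=> u a x y; congr pair => /=;
  rewrite !(lieDl, lieDr, lieZl, lieZr) // scalerBr opprD addrACA.
Qed.

Fact tangent_lie_alternating x : tangent_lie x x = 0.
Proof. by rewrite /tangent_lie lie_alternating subrr. Qed.

Fact tangent_lie_jacobi x y z :
  tangent_lie (tangent_lie x y) z + tangent_lie (tangent_lie y z) x
  + tangent_lie (tangent_lie z x) y = 0.
Proof.
congr pair => /=; first exact: lie_jacobi.
rewrite !(lieDr, lieNr) !lie_lie !opprB.
rewrite [LHS](AC (((2*2)*(2*2))*(2*2))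
  ((1*8)*(2*11)*(3*6)*(4*9)*(5*12)*(7*10)))/=.
by rewrite !subrr !addNr !addr0.
Qed.

HB.instance Definition _ :=
  isLie.Build R tangent
    tangent_lie_bilinear tangent_lie_alternating tangent_lie_jacobi.
End Tangent.

Section Kahler.
Variables (R : fieldType) (g : lieAlgType R).

Definition complex_structure (J : 'End(g)) : Prop :=
  (forall x, J (J x) = - x) /\
  (forall x y,
     lie (J x) (J y) - lie x y - J (lie (J x) y) - J (lie x (J y)) = 0).

Definition two_form (omega : g -> g -> R) : Prop :=
  bilinear_for *%R *%R omega /\ (forall x, omega x x = 0).

Definition form_nondegenerate (omega : g -> g -> R) : Prop :=
  forall x, (forall y, omega x y = 0) -> x = 0.

Definition symplectic_structure (omega : g -> g -> R) : Prop :=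
  [/\ two_form omega, form_nondegenerate omega
    & forall x y z,
        omega (lie x y) z + omega (lie y z) x + omega (lie z x) y = 0].

(* Kaehler in the pseudo-Riemannian sense: no positivity is required. *)
Definition kahler_structure (K : 'End(g) * (g -> g -> R)) : Prop :=
  [/\ complex_structure K.1, symplectic_structure K.2
    & forall x y, K.2 (K.1 x) (K.1 y) = K.2 x y].
End Kahler.

Definition tangent_R_aff (R : fieldType) : lieAlgType R :=
  tangent (R^o * aff R)%type.

(* Main.v *)
Require Import Defs.
From HB Require Import structures.
From mathcomp Require Import all_boot all_order all_algebra.
From mathcomp Require Import reals.
From mathcomp Require Import ring.

(** Over the dual numbers D = R[eps], T(aff(R)) is aff(D), with e_4 = eps e_1
    and e_5 = eps e_2. Extending by D-linearity the Kähler structure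
    J e_1 = e_2, e^1 /\ e^2 of aff(R), and keeping the eps-part of the form,
    gives J e_4 = e_5 and e^15 - e^24, which is non-degenerate. The remaining
    factor span(e_3, e_6) is abelian, so J e_3 = e_6 and any nonzero multiple
    c e^36 complete a Kähler structure; the signature of the metric depends
    on the sign of c. *)

Set Implicit Arguments.
Unset Strict Implicit.
Unset Printing Implicit Defensive.

Import GRing.Theory.
Local Open Scope ring_scope.

Section KahlerFamily.
Variable R : fieldType.
Local Notation T := (tangent_R_aff R).
Implicit Types (x y z : T) (u v : aff R) (c : R).

Lemma aff_ext u v : u 0 0 = v 0 0 -> u 0 1 = v 0 1 -> u = v.
Proof.
move=> uv0 uv1; apply/rowP; case=> [[|[|//]]] i_lt2.
  by rewrite (_ : Ordinal _ = 0) //; apply: val_inj.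
by rewrite (_ : Ordinal _ = 1) //; apply: val_inj.
Qed.

Lemma tangent_R_aff_ext x y :
    x.1.1 = y.1.1 -> x.1.2 0 0 = y.1.2 0 0 -> x.1.2 0 1 = y.1.2 0 1 ->
    x.2.1 = y.2.1 -> x.2.2 0 0 = y.2.2 0 0 -> x.2.2 0 1 = y.2.2 0 1 ->
  x = y.
Proof.
case: x y => [[? ?] [? ?]] [[? ?] [? ?]] /= -> u0 u1 -> v0 v1.
by rewrite (aff_ext u0 u1) (aff_ext v0 v1).
Qed.

Definition aff_rot u : aff R :=
  (- u 0 1) *: delta_mx 0 0 + u 0 0 *: delta_mx 0 1.

Lemma aff_rot0 u : aff_rot u 0 0 = - u 0 1.
Proof. by rewrite !mxE /= mulr1 mulr0 addr0. Qed.

Lemma aff_rot1 u : aff_rot u 0 1 = u 0 0.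
Proof. by rewrite !mxE /= mulr1 mulr0 add0r. Qed.

Definition tangent_rot (x : T) : T :=
  ((- x.2.1, aff_rot x.1.2), (x.1.1, aff_rot x.2.2)).

Lemma tangent_rot_linear : linear tangent_rot.
Proof.
move=> a x y; apply: tangent_R_aff_ext;
  rewrite /= ?mxE /= ?mxE /GRing.scale /=; ring.
Qed.

HB.instance Definition _ :=
  GRing.isLinear.Build R T T *:%R tangent_rot tangent_rot_linear.

Definition kahler_J : 'End(T) := linfun tangent_rot.

(** The first two summands polarise the determinant: they are the eps-part of det over D, that is
    e^15 - e^24. The last one is c e^36. *)
Definition kahler_form c x y : R :=
  (x.1.2 0 0 * y.2.2 0 1 - x.1.2 0 1 * y.2.2 0 0)
  + (x.2.2 0 0 * y.1.2 0 1 - x.2.2 0 1 * y.1.2 0 0)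
  + c * (x.1.1 * y.2.1 - x.2.1 * y.1.1).

Lemma lie_tangentE x y :
  (lie x y : T) =
  ((0, (x.1.2 0 0 * y.1.2 0 1 - x.1.2 0 1 * y.1.2 0 0) *: delta_mx 0 1),
   (0, (x.1.2 0 0 * y.2.2 0 1 - x.1.2 0 1 * y.2.2 0 0
        - (y.1.2 0 0 * x.2.2 0 1 - y.1.2 0 1 * x.2.2 0 0)) *: delta_mx 0 1)).
Proof.
congr pair; congr pair; first exact: subr0.
by rewrite [RHS]scalerBl.
Qed.

(** The Nijenhuis tensor N always satisfies N(x, Jx) = 0. On aff(D) it is alternating and D-bilinear
    with basis e_1, J e_1, so it vanishes; the complement is central and J-stable. *)
Lemma complex_structure_kahler_J : complex_structure kahler_J.
Proof.
split=> [x|x y]; rewrite !lfunE.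
  by apply: tangent_R_aff_ext; rewrite /= ?mxE /= ?mxE /=; ring.
rewrite !lie_tangentE.
by apply: tangent_R_aff_ext; rewrite /= ?mxE /= ?mxE /=; ring.
Qed.

Lemma kahler_form_nondegenerate c :
  c != 0 -> form_nondegenerate (kahler_form c).
Proof.
move=> c0 x x_perp.
(* The form pairs e_1 with e_5, e_2 with e_4 and e_3 with e_6, so testing against a basis vector
   isolates one coordinate of [x], up to sign or a factor [c]. *)
have E s u t v : kahler_form c x ((s, u), (t, v)) = 0 := x_perp _.
pose e0 : aff R := delta_mx 0 0; pose e1 : aff R := delta_mx 0 1.
apply: tangent_R_aff_ext; rewrite /= ?mxE.
- have := E 0 0 1 0; rewrite /kahler_form /= !mxE => h.
  by apply: (mulfI c0); rewrite mulr0 -[RHS]h; ring.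
- by rewrite -[RHS](E 0 0 0 e1) /kahler_form /= !mxE /=; ring.
- apply: oppr_inj; rewrite oppr0 -[RHS](E 0 0 0 e0).
  by rewrite /kahler_form /= !mxE /=; ring.
- have := E 1 0 0 0; rewrite /kahler_form /= !mxE => h.
  by apply: (mulfI c0); apply: oppr_inj; rewrite mulr0 oppr0 -[RHS]h; ring.
- by rewrite -[RHS](E 0 e1 0 0) /kahler_form /= !mxE /=; ring.
- apply: oppr_inj; rewrite oppr0 -[RHS](E 0 e0 0 0).
  by rewrite /kahler_form /= !mxE /=; ring.
Qed.

Lemma kahler_structure_form c :
  c != 0 -> kahler_structure (kahler_J, kahler_form c).
Proof.
move=> c0; split=> /=; first exact: complex_structure_kahler_J.
  split; last 1 first.
  (* Closedness: brackets have no e_3 or e_6 component, and an alternating D-trilinear map on D^2 is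
     zero. *)
  - move=> x y z; rewrite !lie_tangentE /kahler_form /= !mxE /=; ring.
  - split=> [|x]; last by rewrite /kahler_form; ring.
    by split=> z a x y; rewrite /kahler_form /= !mxE /GRing.scale /=; ring.
  - exact: kahler_form_nondegenerate.
(* Quarter turns have determinant 1. *)
move=> x y; rewrite !lfunE /kahler_form /= !(aff_rot0, aff_rot1); ring.
Qed.

(** Evaluation at (e_3, e_6) recovers the parameter. *)
Lemma kahler_form_inj : injective kahler_form.
Proof.
move=> c d /(congr1 (fun w => w ((1, 0), 0) (0, (1, 0)))).
by rewrite /kahler_form /= !mxE !(mul0r, mulr0, mulr1, subr0, add0r).
Qed.

End KahlerFamily.

Theorem lemma5p13 (R : realType) :
  exists K1 K2 :
    'End(tangent_R_aff R) * (tangent_R_aff R -> tangent_R_aff R -> R),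
    [/\ kahler_structure K1, kahler_structure K2 & K1 <> K2].
Proof.
exists (kahler_J R, kahler_form 1), (kahler_J R, kahler_form (-1)).
split; try by apply: kahler_structure_form; rewrite ?oppr_eq0 oner_eq0.
case=> /kahler_form_inj/eqP.
(* Equality of 1 and -1 would give 2 = 0, impossible in characteristic zero. *)
by rewrite -subr_eq0 opprK -(natrD _ 1 1) Num.Theory.pnatr_eq0.
Qed.
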